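(* There exist a finite set $V$ and five paths $P_1, \dots, P_5$ on the vertex set $V$ (each path visiting every vertex of $V$ exactly once) such that $P_1,\dots,P_5$ have no $5$-layer geometric embedding; that is, for every placement of the vertices of $V$ at distinct points of the plane, with all edges drawn as straight segments, the drawing of at least one of the paths $P_i$ has a crossing (is not plane).
   Context: Graphs are finite and simple. Let $G_i = (V, E_i)$, $1 \le i \le k$, be $k$ graphs on the same vertex set $V$ with possibly different edge sets. A $k$-layer geometric embedding (also called a simultaneous geometric embedding with mapping) of $G_1,\dots,G_k$ is an injective map $\phi : V \to \mathbb{R}^2$ such that, when every edge $uv$ is drawn as the straight segment $\overline{\phi(u)\phi(v)}$, for each $i$ the resulting drawing of $G_i$ is plane: two distinct edges of the same $E_i$ meet only at a common endpoint, and no edge of $E_i$ passes through the image of a vertex that is not one of its endpoints. Edges that do not both lie in a common $E_i$ may cross. *)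

(* Defs.v *)
From HB Require Import structures.
From mathcomp Require Import all_boot all_order all_algebra.
From mathcomp Require Import boolp classical_sets set_interval reals.

Set Implicit Arguments.
Unset Strict Implicit.
Unset Printing Implicit Defensive.

Import Order.TTheory GRing.Theory Num.Theory.

Local Open Scope classical_set_scope.
Local Open Scope ring_scope.

Record sgraph (V : finType) := SGraph {
  adj :> rel V;
  adj_sym : symmetric adj;
  adj_irr : irreflexive adj
}.

(* [s] lists every vertex of [V] exactly once, and the edges of [G] are exactly
   the pairs of consecutive entries of [s], in either order. *)
Definition is_spanning_path (V : finType) (G : sgraph V) : Prop :=
  exists s : seq V,
    [/\ uniq s, (forall v : V, v \in s) &
        forall u v : V, G u v = infix [:: u; v] s || infix [:: v; u] s].

Definition segment (R : realType) (p q : 'rV[R]_2) : set 'rV[R]_2 :=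
  [set (1 - t) *: p + t *: q | t in `[0, 1]].

(* Edges are unordered pairs, so distinctness of edges and their common
   endpoints are expressed through the sets of their endpoints. *)
Definition plane_drawing (R : realType) (V : finType) (G : sgraph V)
    (phi : V -> 'rV[R]_2) : Prop :=
  (forall u v x y : V, G u v -> G x y -> [set u; v]%SET != [set x; y]%SET ->
     forall z : 'rV[R]_2,
       segment (phi u) (phi v) z -> segment (phi x) (phi y) z ->
       exists2 w : V, w \in ([set u; v] :&: [set x; y])%SET & z = phi w) /\
  (forall u v w : V, G u v -> w \notin [set u; v]%SET ->
     ~ segment (phi u) (phi v) (phi w)).

Definition geometric_embedding (R : realType) (V : finType) (k : nat)
    (G : 'I_k -> sgraph V) (phi : V -> 'rV[R]_2) : Prop :=
  injective phi /\ forall i : 'I_k, plane_drawing (G i) phi.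

(* Main.v *)
(* In any placement of five points in the plane some two disjoint pairs span
   intersecting segments: were every 4-subset a triangle with a point strictly
   inside, the product of the orientations of the four triples of each 4-subset
   would be negative, but the product of these five numbers is a square since
   each triple lies in exactly two 4-subsets.  The five rotations of the
   Hamiltonian path 1 2 4 3 0 of K_5 put every one of the 15 pairs of disjoint
   edges of K_5 into a common path. *)
Require Import Defs.
From HB Require Import structures.
From mathcomp Require Import all_boot all_order all_algebra.
From mathcomp Require Import boolp classical_sets set_interval reals.
From mathcomp Require Import ring lra.

Set Implicit Arguments.
Unset Strict Implicit.
Unset Printing Implicit Defensive.

Import Order.TTheory GRing.Theory Num.Theory.

Local Open Scope classical_set_scope.
Local Open Scope ring_scope.

Section Plane.
Context {R : realType}.
Implicit Types p q r s : 'rV[R]_2.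

Lemma rV2_eq p q : p 0 0 = q 0 0 -> p 0 1 = q 0 1 -> p = q.
Proof.
move=> e0 e1; apply/rowP; case=> [[|[|//]]] lt_i2.
  by have -> : Ordinal lt_i2 = 0 by exact: val_inj.
by have -> : Ordinal lt_i2 = 1 by exact: val_inj.
Qed.

Lemma in_segment p q (t : R) : 0 <= t <= 1 ->
  segment p q ((1 - t) *: p + t *: q).
Proof. by move=> t01; exists t => //=; rewrite in_itv. Qed.

Lemma segment_left p q : segment p q p.
Proof.
by have := @in_segment p q 0; rewrite subr0 scale1r scale0r addr0; apply; lra.
Qed.

Lemma segment_right p q : segment p q q.
Proof.
by have := @in_segment p q 1; rewrite subrr scale1r scale0r add0r; apply; lra.
Qed.

(** Twice the signed area of the triangle; the sign tells on which side of the line [p q] the point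
    [r] lies. *)
Definition orient p q r : R :=
  (q 0 0 - p 0 0) * (r 0 1 - p 0 1) - (q 0 1 - p 0 1) * (r 0 0 - p 0 0).

Definition segments_meet p q r s := exists2 z, segment p q z & segment r s z.

(** The middle point is [p] for [t < 0], [r] for [t] in the unit interval and [q] for [t > 1];
    solving for it gives a convex combination of the other two. *)
Lemma affine_between p q (t : R) (r := (1 - t) *: p + t *: q) :
  [\/ segment p q r, segment q r p | segment p r q].
Proof.
have [t0|t0] := ltP t 0; last have [t1|t1] := leP t 1.
- apply: Or32; have u0 : 1 - t != 0 by lra.
  have -> : p = (1 - (1 - t)^-1) *: q + (1 - t)^-1 *: r.
    by apply: rV2_eq; rewrite !mxE; field.
  apply: in_segment; rewrite invr_ge0 invf_le1; lra.
- by apply: Or31; apply: in_segment; lra.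
- apply: Or33; have u0 : t != 0 by lra.
  have -> : q = (1 - t^-1) *: p + t^-1 *: r.
    by apply: rV2_eq; rewrite !mxE; field.
  apply: in_segment; rewrite invr_ge0 invf_le1; lra.
Qed.

Lemma collinear_between p q r : orient p q r = 0 ->
  [\/ segment p q r, segment q r p | segment p r q].
Proof.
rewrite /orient => col.
(* The affine parameter of [r] on the line is read off a coordinate in which [p] and [q] differ. *)
have [e0|n0] := eqVneq (q 0 0 - p 0 0) 0.
  have [e1|n1] := eqVneq (q 0 1 - p 0 1) 0.
    have -> : q = p by apply: rV2_eq; lra.
    by apply: Or32; exact: segment_left.
  have -> : r = (1 - (r 0 1 - p 0 1) / (q 0 1 - p 0 1)) *: p
              + ((r 0 1 - p 0 1) / (q 0 1 - p 0 1)) *: q.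
    apply: rV2_eq; rewrite !mxE; last by field.
    have r0 : r 0 0 = p 0 0.
      apply/eqP; rewrite -subr_eq0 -(mulrI_eq0 _ (mulfI n1)); apply/eqP.
      by rewrite e0 in col; lra.
    rewrite r0 (_ : q 0 0 = p 0 0); [ring | lra].
  exact: affine_between.
have -> : r = (1 - (r 0 0 - p 0 0) / (q 0 0 - p 0 0)) *: p
            + ((r 0 0 - p 0 0) / (q 0 0 - p 0 0)) *: q.
  apply: rV2_eq; rewrite !mxE; first by field.
  have -> : r 0 1 = p 0 1 + (r 0 0 - p 0 0) * (q 0 1 - p 0 1) / (q 0 0 - p 0 0).
    rewrite (_ : (r 0 0 - _) * _ = (r 0 1 - p 0 1) * (q 0 0 - p 0 0)).
      by field.
    lra.
  by field.
exact: affine_between.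
Qed.

(** The ratio is the zero of the affine function with value [x] at 0 and [y] at 1, which changes
    sign in between. *)
Lemma ratio_itv (x y : R) : x * y < 0 -> 0 <= x / (x - y) <= 1.
Proof.
move=> xy; have [d|d|d] := ltgtP (x - y) 0.
- by rewrite ler_ndivrMr // ler_ndivlMr //; nra.
- by rewrite ler_pdivlMr // ler_pdivrMr //; nra.
- by nra.
Qed.

(** [orient] is affine in its last argument, so the line [r s] cuts [p q] at the ratio below and
    conversely; both formulas give the intersection point of the two lines. *)
Lemma separated_meet p q r s :
  orient p q r * orient p q s < 0 -> orient r s p * orient r s q < 0 ->
  segments_meet p q r s.
Proof.
move=> hr hp.
have d1 : orient p q r - orient p q s != 0.
  by apply/eqP => d; nra.
have d2 : orient r s p - orient r s q != 0.
  by apply/eqP => d; nra.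
exists ((1 - orient r s p / (orient r s p - orient r s q)) *: p
        + (orient r s p / (orient r s p - orient r s q)) *: q).
  exact/in_segment/ratio_itv.
have -> : (1 - orient r s p / (orient r s p - orient r s q)) *: p
        + (orient r s p / (orient r s p - orient r s q)) *: q
        = (1 - orient p q r / (orient p q r - orient p q s)) *: r
        + (orient p q r / (orient p q r - orient p q s)) *: s.
  by apply: rV2_eq; rewrite !mxE; rewrite /orient in d1 d2 *; field;
    rewrite d1 d2.
exact/in_segment/ratio_itv.
Qed.

Lemma orientC p q r : orient p r q = - orient p q r.
Proof. rewrite /orient; ring. Qed.

Lemma orient_rot p q r : orient q r p = orient p q r.
Proof. rewrite /orient; ring. Qed.

(* In general position this is positive exactly when the four points are in
   convex position. *)
Definition orient4 p q r s :=
  orient p q r * orient p q s * orient p r s * orient q r s.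

(** If a triple is collinear, its middle point lies on the segment of the other two and is an
    endpoint of the segment to the fourth point. Otherwise the product is positive, and the signs of
    two partial products decide which pairing crosses. *)
Lemma orient4_ge0_meet p q r s : 0 <= orient4 p q r s ->
  [\/ segments_meet p q r s, segments_meet p r q s | segments_meet p s q r].
Proof.
rewrite /orient4 => h.
have [/collinear_between[]|nz1] := eqVneq (orient p q r) 0.
- by move=> hz; apply: Or31; exists r => //; exact: segment_left.
- by move=> hz; apply: Or33; exists p => //; exact: segment_left.
- by move=> hz; apply: Or32; exists q => //; exact: segment_left.
have [/collinear_between[]|nz2] := eqVneq (orient p q s) 0.
- by move=> hz; apply: Or31; exists s => //; exact: segment_right.
- by move=> hz; apply: Or32; exists p => //; exact: segment_left.
- by move=> hz; apply: Or33; exists q => //; exact: segment_left.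
have [/collinear_between[]|nz3] := eqVneq (orient p r s) 0.
- by move=> hz; apply: Or32; exists s => //; exact: segment_right.
- by move=> hz; apply: Or31; exists p => //; exact: segment_left.
- by move=> hz; apply: Or33; exists r => //; exact: segment_right.
have [/collinear_between[]|nz4] := eqVneq (orient q r s) 0.
- by move=> hz; apply: Or33; exists s => //; exact: segment_right.
- by move=> hz; apply: Or31; exists q => //; exact: segment_right.
- by move=> hz; apply: Or32; exists r => //; exact: segment_right.
have {}h : 0 < orient p q r * orient p q s * (orient p r s * orient q r s).
  by rewrite mulrA lt_neqAle h andbT eq_sym !mulf_neq0.
have [h1|h1|/eqP] := ltgtP (orient p q r * orient p q s) 0; first last.
- by rewrite mulf_eq0 (negPf nz1) (negPf nz2).
- have h2 : 0 < orient p r s * orient q r s by rewrite -(pmulr_rgt0 _ h1).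
  have [h3|h3|/eqP] := ltgtP (orient p q r * orient p r s) 0; first last.
  + by rewrite mulf_eq0 (negPf nz1) (negPf nz3).
  + apply: Or32; apply: separated_meet.
      by rewrite orientC; nra.
    rewrite (orient_rot p q s) (orientC q r s) mulrN oppr_lt0.
    have := mulr_gt0 (mulr_gt0 h1 h2) h3.
    have -> : orient p q r * orient p q s * (orient p r s * orient q r s) *
        (orient p q r * orient p r s) =
        (orient p q r * orient p r s) ^+ 2 * (orient p q s * orient q r s).
      by ring.
    by rewrite pmulr_rgt0 // exprn_even_gt0 // mulf_neq0.
  + apply: Or33; apply: separated_meet.
      rewrite (orientC p q s) (orientC p r s) mulrNN.
      (* Fixing the sign of the common factor of [h1] and [h3] lets it cancel. *)
      by move: h1 h3; case: (ltgtP (orient p q r) 0) nz1 => // hh _; nra.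
    rewrite (orient_rot p q r).
    by move: h2 h3; case: (ltgtP (orient p r s) 0) nz3 => // hh _; nra.
- have h2 : orient p r s * orient q r s < 0 by rewrite -(nmulr_rgt0 _ h1).
  apply: Or31; apply: separated_meet => //.
  by rewrite (orient_rot p r s) (orient_rot q r s).
Qed.

Lemma orient4_not_all_lt0 (a b c d e : 'rV[R]_2) :
  ~ [/\ orient4 a b c d < 0, orient4 a b c e < 0, orient4 a b d e < 0,
        orient4 a c d e < 0 & orient4 b c d e < 0].
Proof.
move=> [h1 h2 h3 h4 h5].
have : orient4 a b c d * orient4 a b c e * (orient4 a b d e * orient4 a c d e)
       * orient4 b c d e < 0.
  by rewrite pmulr_rlt0 // mulr_gt0 // nmulr_lgt0.
apply/negP; rewrite -leNgt; set x := (X in 0 <= X).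
(* All 4-subsets list their points in the order [a b c d e], so both occurrences of a triple carry
   the same sign. *)
have -> : x = (orient a b c * orient a b d * orient a b e * orient a c d *
  orient a c e * orient a d e * orient b c d * orient b c e * orient b d e *
  orient c d e) ^+ 2 by rewrite /x /orient4; ring.
exact: sqr_ge0.
Qed.

Lemma five_points_meet (phi : 'I_5 -> 'rV[R]_2) : exists a b c d : 'I_5,
  uniq [:: a; b; c; d] /\ segments_meet (phi a) (phi b) (phi c) (phi d).
Proof.
apply: contrapT => no_meet.
have lt0 a b c d : uniq [:: a; b; c; d] ->
    orient4 (phi a) (phi b) (phi c) (phi d) < 0.
  move=> u; rewrite ltNge; apply/negP => /orient4_ge0_meet[] m; apply: no_meet.
  - by exists a, b, c, d.
  - exists a, c, b, d; split=> //.
    rewrite -(perm_uniq (s1 := [:: a; b; c; d])) //.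
    by rewrite perm_cons (perm_catCA [:: b] [:: c]).
  - exists a, d, b, c; split=> //.
    rewrite -(perm_uniq (s1 := [:: a; b; c; d])) //.
    by rewrite perm_cons (perm_catCA [:: b; c] [:: d] [::]).
apply: (@orient4_not_all_lt0 (phi 0) (phi 1) (phi 2%:R) (phi 3%:R) (phi 4%:R)).
by split; apply: lt0.
Qed.

End Plane.

(** Addition in ['I_5] is modulo 5, so these are the rotations of one path. *)
Definition path5 (i : 'I_5) : seq 'I_5 :=
  [seq k + i | k <- [:: 1; 2%:R; 4%:R; 3%:R; 0]].

Definition path5_adj (i : 'I_5) : rel 'I_5 :=
  fun u v => infix [:: u; v] (path5 i) || infix [:: v; u] (path5 i).

(** An explicit list turns quantifiers over ['I_5] into booleans that [vm_compute] evaluates. *)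
Definition ord5 : seq 'I_5 := [:: 0; 1; 2%:R; 3%:R; 4%:R].

Lemma mem_ord5 (v : 'I_5) : v \in ord5.
Proof. by case: v => [[|[|[|[|[|]]]]]]. Qed.

Lemma path5_adj_sym i : symmetric (path5_adj i).
Proof. by move=> u v; rewrite /path5_adj orbC. Qed.

Lemma path5_adj_irr i : irreflexive (path5_adj i).
Proof.
move=> u; apply/negbTE; move: i u.
suff H : all (fun i => all (fun u => ~~ path5_adj i u u) ord5) ord5.
  by move=> i u; exact: (allP (allP H _ (mem_ord5 i)) _ (mem_ord5 u)).
by vm_compute.
Qed.

Definition path5_graph i := SGraph (path5_adj_sym i) (@path5_adj_irr i).

Lemma path5_graph_spanning i : is_spanning_path (path5_graph i).
Proof.
exists (path5 i); split => //.
  by apply: (allP (_ : all (fun i => uniq (path5 i)) ord5)) (mem_ord5 i).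
move=> v; have H : all (fun i => all (mem (path5 i)) ord5) ord5 by vm_compute.
exact: (allP (allP H _ (mem_ord5 i)) _ (mem_ord5 v)).
Qed.

(** Each path has three pairs of disjoint edges, so five paths have just enough for all 15; the
    covering is checked exhaustively. *)
Lemma disjoint_edges_common_path (a b c d : 'I_5) : uniq [:: a; b; c; d] ->
  exists i, path5_graph i a b /\ path5_graph i c d.
Proof.
have H : all (fun a => all (fun b => all (fun c => all (fun d =>
    uniq [:: a; b; c; d] ==>
    has (fun i => path5_adj i a b && path5_adj i c d) ord5)
  ord5) ord5) ord5) ord5 by vm_compute.
have /implyP K := allP (allP (allP (allP H _ (mem_ord5 a)) _ (mem_ord5 b))
  _ (mem_ord5 c)) _ (mem_ord5 d).
by move=> /K /hasP[i _ /andP[Gab Gcd]]; exists i.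
Qed.

Theorem theorem2 (R : realType) :
  exists (V : finType) (P : 'I_5 -> sgraph V),
    (forall i : 'I_5, is_spanning_path (P i)) /\
    ~ (exists phi : V -> 'rV[R]_2, geometric_embedding P phi).
Proof.
exists 'I_5, path5_graph; split; first exact: path5_graph_spanning.
move=> [phi [_ plane]].
have [a [b [c [d [abcd [z zab zcd]]]]]] := five_points_meet phi.
have [i [Gab Gcd]] := disjoint_edges_common_path abcd.
have disj w : w \notin ([set a; b] :&: [set c; d])%SET.
  move: abcd; rewrite /= !inE !negb_or =>
    /and4P[/and3P[_ ac ad] /andP[bc bd] _ _].
  apply/negP => /andP[/orP[]/eqP-> /orP[]/eqP e].
  - by rewrite e eqxx in ac.
  - by rewrite e eqxx in ad.
  - by rewrite e eqxx in bc.
  - by rewrite e eqxx in bd.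
have ne : ([set a; b] != [set c; d])%SET.
  by apply/eqP => e; have := disj a; rewrite -e finset.setIid !inE eqxx.
(* Planarity of path [i] would make [z] the image of a common endpoint of two disjoint edges. *)
have [w] := (plane i).1 a b c d Gab Gcd ne z zab zcd.
by rewrite (negPf (disj w)).
Qed.
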